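(* For every positive equivalence relation $\eta$, the ascending family $\mathcal{A}_\eta=\{A_n : n\in\mathbb{N}\}$ is explanatorily learnable but not confidently learnable. Moreover, $\mathcal{A}_\eta\cup\{\mathbb{N}\}$ is an $\eta$-family which is not behaviourally correctly learnable.
   Context: A positive equivalence relation is an equivalence relation $\eta$ on $\mathbb{N}$ that is recursively enumerable (as a set of pairs) and has infinitely many equivalence classes. For $x\in\mathbb N$ let $[x]=\{y: y\,\eta\,x\}$, for $D\subseteq \mathbb N$ let $[D]=\bigcup_{x\in D}[x]$, and write $[b_1,\dots,b_k]$ for $[\{b_1,\dots,b_k\}]$. Let $a_0<a_1<a_2<\cdots$ be the least elements of the $\eta$-equivalence classes, listed in increasing order, and $A_n=[a_0,\dots,a_{n-1}]$ (so $A_0=\emptyset$). A set is $\eta$-closed if it is a union of $\eta$-classes. An $\eta$-family is an infinite family of $\eta$-closed sets possessing a uniformly r.e. one-one numbering $B_0,B_1,\dots$ (i.e. $\{\langle k,x\rangle:x\in B_k\}$ is r.e. and $B_i\neq B_j$ for $i\ne j$). $W_0,W_1,\dots$ is a fixed acceptable numbering of the r.e. sets. A text for $L$ is a total $T:\mathbb N\to\mathbb N\cup\{\#\}$ whose range minus $\{\#\}$ is $L$; $T[n]$ is its initial segment of length $n$. A learner is a recursive function $M$ from finite sequences over $\mathbb N\cup\{\#\}$ to $\mathbb N\cup\{?\}$; an output $e$ is interpreted as the hypothesis ''the $\eta$-closure of $W_e$''. A family $\mathcal C$ is explanatorily learnable if some $M$, on every text $T$ for every $L\in\mathcal C$, outputs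 from some point on a single index $e$ whose hypothesis equals $L$; behaviourally correctly learnable if some $M$, on every such text, outputs for almost all $n$ an index $M(T[n])$ whose hypothesis equals $L$; confidently learnable if some $M$ explanatorily learns $\mathcal C$ and additionally, on every text for every set $L\subseteq\mathbb N$, the sequence $M(T[n])$ converges. *)

(* Defs.v *)
(* MathComp, with the classical sets of MathComp-Analysis. *)
From mathcomp Require Import all_boot.
From mathcomp Require Import boolp classical_sets functions cardinality.

Set Implicit Arguments.
Unset Strict Implicit.
Unset Printing Implicit Defensive.

Local Open Scope classical_set_scope.
Local Open Scope nat_scope.

(* Total recursive functions, after Kleene: minimization is applied only to
   functions for which the search always succeeds. *)
Inductive recursive : forall n, (n.-tuple nat -> nat) -> Prop :=
| rec_zero n : recursive (fun _ : n.-tuple nat => 0)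
| rec_succ : recursive (fun t : 1.-tuple nat => (thead t).+1)
| rec_proj n (i : 'I_n) : recursive (fun t : n.-tuple nat => tnth t i)
| rec_comp n k (f : k.-tuple nat -> nat) (g : 'I_k -> n.-tuple nat -> nat) :
    recursive f -> (forall i, recursive (g i)) ->
    recursive (fun t : n.-tuple nat => f [tuple g i t | i < k])
| rec_prim n (f : n.-tuple nat -> nat) (g : n.+2.-tuple nat -> nat)
    (h : n.+1.-tuple nat -> nat) :
    recursive f -> recursive g ->
    (forall t : n.-tuple nat, h [tuple of 0 :: t] = f t) ->
    (forall m (t : n.-tuple nat),
       h [tuple of m.+1 :: t] = g [tuple of m :: h [tuple of m :: t] :: t]) ->
    recursive h
| rec_mu n (f : n.+1.-tuple nat -> nat) (h : n.-tuple nat -> nat) :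
    recursive f ->
    (forall t : n.-tuple nat, f [tuple of h t :: t] = 0) ->
    (forall (t : n.-tuple nat) m, m < h t -> f [tuple of m :: t] <> 0) ->
    recursive h.

Definition recursive1 (f : nat -> nat) : Prop :=
  recursive (fun t : 1.-tuple nat => f (thead t)).

(* Cantor's bijection from pairs to numbers. *)
Definition npair (x y : nat) : nat := ((x + y) * (x + y).+1)./2 + x.

Definition re (S : set nat) : Prop :=
  S = set0 \/ exists2 f, recursive1 f & S = range f.

(* For B : nat -> set nat, [re2 B] says that B 0, B 1, and so on are uniformly
   r.e. *)
Definition re2 (R : nat -> nat -> Prop) : Prop :=
  re [set npair p.1 p.2 | p in [set p : nat * nat | R p.1 p.2]].

(* Every r.e. set is some W e: apply the second clause to a constant V. *)
Definition acceptable_numbering (W : nat -> set nat) : Prop :=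
  re2 W /\
  forall V : nat -> set nat, re2 V ->
    exists2 f, recursive1 f & forall i, V i = W (f i).

Definition eta_class (eta : nat -> nat -> Prop) (x : nat) : set nat :=
  [set y | eta y x].

Definition eta_closure (eta : nat -> nat -> Prop) (D : set nat) : set nat :=
  \bigcup_(x in D) eta_class eta x.

Definition eta_closed (eta : nat -> nat -> Prop) (B : set nat) : Prop :=
  exists D : set nat, B = eta_closure eta D.

Definition positive_equivalence (eta : nat -> nat -> Prop) : Prop :=
  [/\ (forall x, eta x x),
      (forall x y, eta x y -> eta y x),
      (forall x y z, eta x y -> eta y z -> eta x z),
      re2 eta
    & infinite_set (range (eta_class eta))].

Definition least_elements (eta : nat -> nat -> Prop) : set nat :=
  [set x | forall y, eta_class eta x y -> x <= y].

Definition lists_increasingly (S : set nat) (a : nat -> nat) : Prop :=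
  (forall m n, m < n -> a m < a n) /\ range a = S.

(* The default [id] is never used: see [least_seqP]. *)
Definition least_seq (eta : nat -> nat -> Prop) : nat -> nat :=
  xget (id : nat -> nat) [set a | lists_increasingly (least_elements eta) a].

Definition ascending (eta : nat -> nat -> Prop) (n : nat) : set nat :=
  eta_closure eta [set least_seq eta i | i in [set i | i < n]].

Definition ascending_family (eta : nat -> nat -> Prop) : set (set nat) :=
  range (ascending eta).

Definition eta_family (eta : nat -> nat -> Prop) (C : set (set nat)) : Prop :=
  [/\ infinite_set C,
      (forall L, C L -> eta_closed eta L)
    & exists B : nat -> set nat, [/\ re2 B, injective B & range B = C]].

(* In texts [None] is the pause symbol #; as a learner's output it is ?. *)
Definition text_for (L : set nat) (T : nat -> option nat) : Prop :=
  [set x | exists n, T n = Some x] = L.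

Definition prefix_of (T : nat -> option nat) (n : nat) : seq (option nat) :=
  mkseq T n.

Definition code_option (o : option nat) : nat :=
  if o is Some x then x.+1 else 0.

Fixpoint code_seq (s : seq (option nat)) : nat :=
  if s is o :: s' then (npair (code_option o) (code_seq s')).+1 else 0.

Definition learner (M : seq (option nat) -> option nat) : Prop :=
  exists2 f, recursive1 f & forall s, f (code_seq s) = code_option (M s).

Section Learning.
Variables (W : nat -> set nat) (eta : nat -> nat -> Prop).
Implicit Types (M : seq (option nat) -> option nat) (C : set (set nat)).

Definition hypothesis (e : nat) : set nat := eta_closure eta (W e).

Definition Ex_learns M C : Prop :=
  forall L T, C L -> text_for L T ->
    exists e, hypothesis e = L /\
      exists n0, forall n, n0 <= n -> M (prefix_of T n) = Some e.

Definition BC_learns M C : Prop :=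
  forall L T, C L -> text_for L T ->
    exists n0, forall n, n0 <= n ->
      exists2 e, M (prefix_of T n) = Some e & hypothesis e = L.

Definition converges_on M (T : nat -> option nat) : Prop :=
  exists o n0, forall n, n0 <= n -> M (prefix_of T n) = o.

Definition explanatorily_learnable C : Prop :=
  exists2 M, learner M & Ex_learns M C.

Definition behaviourally_correctly_learnable C : Prop :=
  exists2 M, learner M & BC_learns M C.

Definition confidently_learnable C : Prop :=
  exists M, [/\ learner M, Ex_learns M C
    & forall L T, text_for L T -> converges_on M T].

End Learning.

Lemma lists_increasingly_exists (S : set nat) :
  infinite_set S -> exists a, lists_increasingly S a.
Proof.
move=> infS.
have nextP n : exists m, (n <= m) && `[< S m >].
  apply: contrapT => nS; apply: infS.
  apply: (sub_finite_set _ (finite_II n)) => m Sm /=.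
  rewrite ltnNge; apply/negP => nm; apply: nS; exists m.
  by rewrite nm; apply/asboolP.
pose g n := ex_minn (nextP n).
pose fix a n := if n is k.+1 then g (a k).+1 else g 0.
have gge n : n <= g n by rewrite /g; case: ex_minnP => m /andP[].
have gS n : S (g n) by rewrite /g; case: ex_minnP => m /andP[_ /asboolP].
have gmin n m : n <= m -> S m -> g n <= m.
  move=> nm Sm; rewrite /g; case: ex_minnP => k _; apply.
  by rewrite nm; apply/asboolP.
have aS n : a n < a n.+1 by exact: gge.
have amono m n : m < n -> a m < a n.
  elim: n => // n IHn; rewrite ltnS leq_eqVlt => /predU1P[->|/IHn lt_ma].
    exact: aS.
  exact: ltn_trans lt_ma (aS n).
have age n : n <= a n by elim: n => // n /leq_ltn_trans; apply.
exists a; split=> //; apply/seteqP; split=> [_ [[|n] _ <-] | m Sm].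
- exact: gS.
- exact: gS.
have exm : exists n, m <= a n by exists m.
case: (ex_minnP exm) => -[|n] man minn; [exists 0 | exists n.+1] => //.
  by apply/eqP; rewrite eqn_leq man andbT; exact: gmin.
apply/eqP; rewrite eqn_leq man andbT; apply: gmin => //.
by rewrite ltnNge; apply/negP => /minn; rewrite ltnn.
Qed.

Lemma least_seqP (eta : nat -> nat -> Prop) : positive_equivalence eta ->
  lists_increasingly (least_elements eta) (least_seq eta).
Proof.
move=> [erefl esym etrans _ inf].
have infS : infinite_set (least_elements eta).
  move=> fin; apply: inf.
  apply: (sub_finite_set _ (finite_image (eta_class eta) fin)) => _ [x _ <-].
  have ex : exists m, `[< eta m x >] by exists x; apply/asboolP.
  case: (ex_minnP ex) => m /asboolP mx mmin.
  exists m; first by move=> y ym; apply/mmin/asboolP/(etrans _ m).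
  apply/seteqP; split=> y /= yx; first exact: etrans mx.
  by apply: etrans yx _; exact: esym.
have [a aP] := lists_increasingly_exists infS.
exact: (xgetI (id : nat -> nat) aP).
Qed.

(* Main.v *)
Require Import Defs.
From mathcomp Require Import all_boot.
From mathcomp Require Import boolp classical_sets functions cardinality.

(* Write a_n for the n-th least element. All numbers below a_n lie in A_n, while
   a_n does not, so on any text for A_n the least number not seen so far
   converges to a_n, and A_n is the closure of {x | x < a_n}.
   Conversely, a learner of all A_n can be fed longer and longer prefixes, the
   n-th having content in A_n and provoking a conjecture for A_n; their limit
   is a text for all of nat on which the learner conjectures every A_n, so that it
   neither converges nor ends up conjecturing nat. This needs no computability.
   Finally, y < a_k iff at most k least elements are <= y; as the non-least
   elements are r.e., this is an r.e. condition, so the A_k are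
   uniformly r.e. *)

Set Implicit Arguments.
Unset Strict Implicit.
Unset Printing Implicit Defensive.

Local Open Scope classical_set_scope.
Local Open Scope nat_scope.

(** * Closure properties of recursive functions *)

Lemma recursive_cst n (k : nat) : recursive (fun _ : n.-tuple nat => k).
Proof.
elim: k => [|k IHk]; first exact: rec_zero.
have := @rec_comp n 1 _ (fun _ _ => k) rec_succ (fun _ => IHk).
by congr recursive; apply/funext => t; rewrite /thead tnth_mktuple.
Qed.

Lemma recursive_app1 n (f : nat -> nat) (g : n.-tuple nat -> nat) :
  recursive1 f -> recursive g -> recursive (fun t => f (g t)).
Proof.
move=> rf rg; have := @rec_comp n 1 _ (fun _ => g) rf (fun _ => rg).
by congr recursive; apply/funext => t; rewrite /thead tnth_mktuple.
Qed.

Lemma recursive_S n (g : n.-tuple nat -> nat) :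
  recursive g -> recursive (fun t => (g t).+1).
Proof. exact: (recursive_app1 rec_succ). Qed.

Lemma recursive_head n : recursive (fun t : n.+1.-tuple nat => thead t).
Proof. exact: rec_proj. Qed.

Lemma recursive_behead n (f : n.-tuple nat -> nat) :
  recursive f -> recursive (fun t : n.+1.-tuple nat => f (behead_tuple t)).
Proof.
move=> rf.
have := @rec_comp n.+1 n f (fun i t => tnth t (lift ord0 i)) rf
  (fun i => rec_proj (lift ord0 i)).
congr recursive; apply/funext => t; congr f; apply: eq_from_tnth => i.
rewrite tnth_mktuple tnth_behead; congr tnth.
by apply: val_inj; rewrite /= inordK ?ltnS.
Qed.

Lemma recursive_cons n (f : n.+1.-tuple nat -> nat) (c : n.-tuple nat -> nat) :
  recursive f -> recursive c -> recursive (fun t => f [tuple of c t :: t]).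
Proof.
move=> rf rc.
pose g (i : 'I_n.+1) (t : n.-tuple nat) := tnth [tuple of c t :: t] i.
have rg i : recursive (g i).
  case: (unliftP ord0 i) => [j ->|->] /=.
  - have := rec_proj j; congr recursive; apply/funext => t.
    by rewrite /g tnthS.
  - by have := rc; congr recursive; apply/funext => t; rewrite /g tnth0.
have := rec_comp rf rg; congr recursive; apply/funext => t; congr f.
by apply: eq_from_tnth => i; rewrite tnth_mktuple.
Qed.

(** [rec_prim] recurses on the first entry of the tuple, whereas here the number of rounds [c t] is
    computed from the parameters. It is substituted for that entry at the end, by
    [recursive_cons]. *)
Lemma recursive_nat_rect n (c b : n.-tuple nat -> nat)
    (s : nat -> nat -> n.-tuple nat -> nat) :
  recursive c -> recursive b ->
  recursive (fun u : n.+2.-tuple nat =>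
    s (thead u) (thead (behead_tuple u)) (behead_tuple (behead_tuple u))) ->
  recursive (fun t => nat_rect (fun _ => nat) (b t) (fun m r => s m r t) (c t)).
Proof.
move=> rc rb rs.
pose h (u : n.+1.-tuple nat) := nat_rect (fun _ => nat) (b (behead_tuple u))
  (fun m r => s m r (behead_tuple u)) (thead u).
have beK x (t : n.-tuple nat) : behead_tuple [tuple of x :: t] = t.
  exact: val_inj.
have beK2 x y (t : n.-tuple nat) :
    behead_tuple (behead_tuple [tuple of x :: y :: t]) = t.
  exact: val_inj.
have rh : recursive h.
  apply: (rec_prim rb rs) => [t|m t]; by rewrite /h !theadE !beK ?beK2.
have := recursive_cons rh rc; congr recursive; apply/funext => t.
by rewrite /h theadE beK.
Qed.

Lemma recursive_add n (g h : n.-tuple nat -> nat) :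
  recursive g -> recursive h -> recursive (fun t => g t + h t).
Proof.
move=> rg rh.
have := recursive_nat_rect (s := fun _ r _ => r.+1) rg rh
  (recursive_S (recursive_behead (recursive_head _))).
by congr recursive; apply/funext => t; elim: (g t) => //= m ->.
Qed.

Lemma recursive_mul n (g h : n.-tuple nat -> nat) :
  recursive g -> recursive h -> recursive (fun t => g t * h t).
Proof.
move=> rg rh.
have := recursive_nat_rect (s := fun _ r t => h t + r) rg (recursive_cst n 0)
  (recursive_add (recursive_behead (recursive_behead rh))
    (recursive_behead (recursive_head _))).
by congr recursive; apply/funext => t; elim: (g t) => //= m ->.
Qed.

Lemma recursive_pred n (g : n.-tuple nat -> nat) :
  recursive g -> recursive (fun t => (g t).-1).
Proof.
move=> rg.
have := recursive_nat_rect (s := fun m _ _ => m) rg (recursive_cst n 0)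
  (recursive_head _).
by congr recursive; apply/funext => t; case: (g t).
Qed.

Lemma recursive_sub n (g h : n.-tuple nat -> nat) :
  recursive g -> recursive h -> recursive (fun t => g t - h t).
Proof.
move=> rg rh.
have := recursive_nat_rect (s := fun _ r _ => r.-1) rh rg
  (recursive_pred (recursive_behead (recursive_head _))).
congr recursive; apply/funext => t; elim: (h t) => [|m /= ->] /=.
  by rewrite subn0.
by rewrite subnS.
Qed.

Lemma recursive_iter n (f : nat -> nat) (c b : n.-tuple nat -> nat) :
  recursive1 f -> recursive c -> recursive b ->
  recursive (fun t => iter (c t) f (b t)).
Proof.
move=> rf rc rb.
have := recursive_nat_rect (s := fun _ r _ => f r) rc rb
  (recursive_app1 rf (recursive_behead (recursive_head _))).
by congr recursive; apply/funext => t; elim: (c t) => //= m ->.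
Qed.

(** * Decidable predicates and bounded quantifiers *)

Definition decidable_on n (P : n.-tuple nat -> bool) : Prop :=
  recursive (fun t => P t : nat).

Lemma decidable_leq n (g h : n.-tuple nat -> nat) :
  recursive g -> recursive h -> decidable_on (fun t => g t <= h t).
Proof.
move=> rg rh.
have := recursive_sub (recursive_cst n 1) (recursive_sub rg rh).
by congr recursive; apply/funext => t; rewrite /leq; case: (g t - h t).
Qed.

Lemma decidable_neg n (P : n.-tuple nat -> bool) :
  decidable_on P -> decidable_on (fun t => ~~ P t).
Proof.
move=> rP; have := recursive_sub (recursive_cst n 1) rP.
by congr recursive; apply/funext => t; case: (P t).
Qed.

Lemma decidable_and n (P Q : n.-tuple nat -> bool) :
  decidable_on P -> decidable_on Q -> decidable_on (fun t => P t && Q t).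
Proof.
move=> rP rQ; have := recursive_mul rP rQ.
by congr recursive; apply/funext => t; case: (P t); case: (Q t).
Qed.

Lemma decidable_or n (P Q : n.-tuple nat -> bool) :
  decidable_on P -> decidable_on Q -> decidable_on (fun t => P t || Q t).
Proof.
move=> rP rQ.
have := decidable_neg
  (decidable_and (decidable_neg rP) (decidable_neg rQ)).
by congr recursive; apply/funext => t; case: (P t); case: (Q t).
Qed.

Lemma decidable_eq n (g h : n.-tuple nat -> nat) :
  recursive g -> recursive h -> decidable_on (fun t => g t == h t).
Proof.
move=> rg rh.
have := decidable_and (decidable_leq rg rh)
  (decidable_leq rh rg).
by congr recursive; apply/funext => t; rewrite eqn_leq.
Qed.

Lemma recursive_if n (P : n.-tuple nat -> bool) (g h : n.-tuple nat -> nat) :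
  decidable_on P -> recursive g -> recursive h ->
  recursive (fun t => if P t then g t else h t).
Proof.
move=> rP rg rh.
have := recursive_add (recursive_mul rP rg)
  (recursive_mul (decidable_neg rP) rh).
congr recursive; apply/funext => t.
by case: (P t); rewrite ?mul1n ?mul0n ?addn0.
Qed.

(** Counting is the one bounded operator that is built from recursion. Both bounded quantifiers
    reduce to it, and so do the bounded searches below, where the sought number is the size of an
    initial segment. *)
Lemma recursive_count n (c : n.-tuple nat -> nat)
    (P : n.-tuple nat -> nat -> bool) :
  recursive c ->
  decidable_on (fun u : n.+1.-tuple nat => P (behead_tuple u) (thead u)) ->
  recursive (fun t => count (P t) (iota 0 (c t))).
Proof.
move=> rc rP.
have rP2 : recursive (fun u : n.+2.-tuple nat =>
    P (behead_tuple (behead_tuple u)) (thead u) : nat).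
  (* The entries of [u] are the counter, the running count and the parameters. [d] deletes the
     running count, on which [P] does not depend. *)
  pose d := fun i : 'I_n.+1 =>
    if unlift ord0 i is Some j then
      fun u : n.+2.-tuple nat => tnth u (lift ord0 (lift ord0 j))
    else fun u => tnth u ord0.
  have rd i : recursive (d i) by rewrite /d; case: unlift => *; exact: rec_proj.
  have := rec_comp rP rd; congr recursive; apply/funext => u.
  set v := [tuple _ | i < _].
  have -> : thead v = thead u by rewrite /thead tnth_mktuple /d unlift_none.
  suff -> : behead_tuple v = behead_tuple (behead_tuple u) by [].
  apply: eq_from_tnth => i.
  have inordS k (j : 'I_k) : inord j.+1 = lift ord0 j.
    by apply: val_inj; rewrite /= inordK ?ltnS.
  by rewrite !tnth_behead tnth_mktuple !inordS /d liftK.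
have := recursive_nat_rect (s := fun m r t => P t m + r) rc (recursive_cst n 0)
  (recursive_add rP2 (recursive_behead (recursive_head _))).
congr recursive; apply/funext => t; elim: (c t) => [//|m IHm].
by rewrite -addn1 iotaD count_cat -IHm addn1 /= addn0 addnC.
Qed.

Lemma decidable_has n (c : n.-tuple nat -> nat)
    (P : n.-tuple nat -> nat -> bool) :
  recursive c ->
  decidable_on (fun u : n.+1.-tuple nat => P (behead_tuple u) (thead u)) ->
  decidable_on (fun t => has (P t) (iota 0 (c t))).
Proof.
move=> rc rP.
have := decidable_leq (recursive_cst n 1) (recursive_count rc rP).
by congr recursive; apply/funext => t; rewrite has_count.
Qed.

Lemma decidable_all n (c : n.-tuple nat -> nat)
    (P : n.-tuple nat -> nat -> bool) :
  recursive c ->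
  decidable_on (fun u : n.+1.-tuple nat => P (behead_tuple u) (thead u)) ->
  decidable_on (fun t => all (P t) (iota 0 (c t))).
Proof.
move=> rc rP; have := decidable_eq (recursive_count rc rP) rc.
congr recursive; apply/funext => t.
by rewrite all_count size_iota.
Qed.

Ltac recursive_step :=
  lazymatch goal with
  | |- recursive (fun t => (_).+1) => apply: recursive_S
  | |- recursive (fun t => _ + _) => apply: recursive_add
  | |- recursive (fun t => _ * _) => apply: recursive_mul
  | |- recursive (fun t => count _ _) => apply: recursive_count
  | |- recursive (@thead _ _) => exact: recursive_head
  | |- recursive (fun t => thead (behead_tuple t)) =>
      exact: (recursive_behead (recursive_head _))
  | |- recursive (fun t => thead (behead_tuple (behead_tuple t))) =>
      exact: (recursive_behead (recursive_behead (recursive_head _)))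
  | |- recursive (fun t => thead (behead_tuple (behead_tuple (behead_tuple t)))) =>
      exact: (recursive_behead (recursive_behead (recursive_behead
        (recursive_head _))))
  | |- decidable_on (fun t => _ <= _) => apply: decidable_leq
  end.

Ltac prove_recursive := repeat (recursive_step || assumption).

(** * Inverting Cantor's pairing *)

Definition tri (w : nat) : nat := (w * w.+1)./2.

(* The x + y for which c = npair x y: the number of i > 0 with tri i <= c. *)
Definition diag (c : nat) : nat := count (fun i => tri i.+1 <= c) (iota 0 c).

(** This inverts [npair x y = tri (x + y) + x] once the diagonal [x + y] is known. *)
Definition ufst (c : nat) : nat := c - tri (diag c).

Definition usnd (c : nat) : nat := diag c - ufst c.

(** This replaces minimization: the threshold of a decidable initial segment is computed by counting
    up to any bound that is large enough. It serves [diag], halving and [mex]. *)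
Lemma count_ltn_iota (P : nat -> bool) (k m : nat) :
  (forall i, P i = (i < k)) -> k <= m -> count P (iota 0 m) = k.
Proof.
move=> Pk km; rewrite -(subnKC km) iotaD count_cat add0n.
have /eqP -> : count P (iota k (m - k)) == 0.
  rewrite -leqn0 leqNgt -has_count; apply/hasPn => i.
  by rewrite mem_iota Pk -leqNgt => /andP[].
rewrite addn0 -[RHS](size_iota 0); apply/eqP; rewrite -all_count.
by apply/allP => i; rewrite mem_iota Pk.
Qed.

Lemma triS w : tri w.+1 = w.+1 + tri w.
Proof.
have triE v : tri v = 'C(v.+1, 2) by rewrite bin2 mulnC.
by rewrite !triE binS bin1 addnC.
Qed.

Lemma leq_tri : {mono tri : w v / w <= v}.
Proof.
apply: leq_mono; apply: homo_ltn => [? ? ?|w]; first exact: ltn_trans.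
by rewrite triS ltnS leq_addl.
Qed.

Lemma leq_tri_id w : w <= tri w.
Proof. by case: w => // w; rewrite triS leq_addr. Qed.

(** Since [x <= x + y], the code lies between [tri (x + y)] and [tri (x + y).+1], the latter
    excluded. *)
Lemma diag_npair x y : diag (npair x y) = x + y.
Proof.
apply: count_ltn_iota => [i|]; last first.
  exact: leq_trans (leq_tri_id _) (leq_addr _ _).
rewrite /npair -/(tri (x + y)) ltnNge; apply/idP/idP => [|].
  apply: contraTN => xyi; rewrite -ltnNge (@leq_trans (tri (x + y).+1)) //.
    by rewrite triS addnC ltn_add2r ltnS leq_addr.
  by rewrite leq_tri.
by rewrite -ltnNge -leq_tri => h; apply: leq_trans h (leq_addr _ _).
Qed.

Lemma ufst_npair x y : ufst (npair x y) = x.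
Proof. by rewrite /ufst diag_npair addKn. Qed.

Lemma usnd_npair x y : usnd (npair x y) = y.
Proof. by rewrite /usnd diag_npair ufst_npair addKn. Qed.

Lemma npair_inj x y x' y' : npair x y = npair x' y' -> x = x' /\ y = y'.
Proof.
move=> e; split; first by rewrite -(ufst_npair x y) e ufst_npair.
by rewrite -(usnd_npair x y) e usnd_npair.
Qed.

Lemma recursive_half n (g : n.-tuple nat -> nat) :
  recursive g -> recursive (fun t => (g t)./2).
Proof.
move=> rg.
have : recursive (fun t => count (fun i => i.+1 + i.+1 <= g t) (iota 0 (g t))).
  prove_recursive; exact: recursive_behead.
congr recursive; apply/funext => t; apply: count_ltn_iota => [i|].
  by rewrite addnn -geq_half_double.
by rewrite leq_half_double -addnn -addnS leq_addr.
Qed.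

Lemma recursive1_tri : recursive1 tri.
Proof. by rewrite /recursive1 /tri; apply: recursive_half; prove_recursive. Qed.

Lemma recursive_npair n (g h : n.-tuple nat -> nat) :
  recursive g -> recursive h -> recursive (fun t => npair (g t) (h t)).
Proof.
move=> rg rh; apply: recursive_add => //.
by apply: (recursive_app1 recursive1_tri); exact: recursive_add.
Qed.

Lemma recursive1_diag : recursive1 diag.
Proof.
apply: recursive_count; first exact: recursive_head.
apply: decidable_leq; last by prove_recursive.
by apply: (recursive_app1 recursive1_tri); prove_recursive.
Qed.

Lemma recursive1_ufst : recursive1 ufst.
Proof.
apply: recursive_sub; first exact: recursive_head.
exact: (recursive_app1 recursive1_tri recursive1_diag).
Qed.

Lemma recursive1_usnd : recursive1 usnd.
Proof. exact: (recursive_sub recursive1_diag recursive1_ufst). Qed.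

(** * Recursively enumerable relations *)

Lemma re2_projection (P : nat -> nat -> nat -> bool) :
  decidable_on (fun t : 1.-tuple nat =>
    P (ufst (thead t)) (ufst (usnd (thead t))) (usnd (usnd (thead t)))) ->
  re2 (fun m x => exists w, P m x w).
Proof.
move=> rP.
have [[c Pc]|noP] := pselect (exists c,
    P (ufst c) (ufst (usnd c)) (usnd (usnd c))); last first.
  left; apply/seteqP; split=> // _ [[m x] /= [w Pw] _]; apply: noP.
  by exists (npair m (npair x w)); rewrite !(ufst_npair, usnd_npair).
(* A nonempty r.e. set must be the range of a total function. So [k] is read as a triple of [m], [x]
   and the witness, and when [P] fails there, the pair from the known solution [c] is output
   instead. *)
pose f k := if P (ufst k) (ufst (usnd k)) (usnd (usnd k))
  then npair (ufst k) (ufst (usnd k)) else npair (ufst c) (ufst (usnd c)).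
right; exists f.
  apply: recursive_if => //; last exact: recursive_cst.
  apply: recursive_npair; first exact: recursive1_ufst.
  exact: (recursive_app1 recursive1_ufst recursive1_usnd).
apply/seteqP; split=> [_ [[m x] /= [w Pw] <-]|_ [k _ <-]].
  exists (npair m (npair x w)) => //.
  by rewrite /f !(ufst_npair, usnd_npair) Pw.
rewrite /f; case: ifP => Pk.
  by exists (ufst k, ufst (usnd k)) => //; exists (usnd (usnd k)).
by exists (ufst c, ufst (usnd c)) => //; exists (usnd (usnd c)).
Qed.

Lemma re2_enumeration (R : nat -> nat -> Prop) : re2 R -> (exists x y, R x y) ->
  exists2 f, recursive1 f & forall x y, R x y <-> exists t, f t = npair x y.
Proof.
move=> [R0 [x [y Rxy]]|[f rf Rf] _].
  suff : set0 (npair x y) by [].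
  by rewrite -R0; exists (x, y).
exists f => // x y; split=> [Rxy|[t ft]].
  have : range f (npair x y) by rewrite -Rf; exists (x, y).
  by case=> t _ <-; exists t.
have : range f (npair x y) by exists t.
by rewrite -Rf => -[[x' y'] /= Rxy /npair_inj[<- <-]].
Qed.

(** * The least number missing from a coded sequence *)

Definition code_head (c : nat) : nat := ufst c.-1.

Definition code_behead (c : nat) : nat := usnd c.-1.

(** Positions past the end are harmless: [code_head] and [code_behead] send 0 to 0, which is the
    code of the pause symbol and never equals [x.+1]. *)
Definition code_mem (x c : nat) : bool :=
  has (fun i => code_head (iter i code_behead c) == x.+1) (iota 0 c).

(* The bound c is large enough when c codes a sequence: see [size_code_seq]. *)
Definition mex (c : nat) : nat :=
  count (fun x => all (fun y => code_mem y c) (iota 0 x.+1)) (iota 0 c).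

Lemma recursive1_mex : recursive1 mex.
Proof.
have rhead : recursive1 code_head.
  exact: (recursive_app1 recursive1_ufst (recursive_pred (recursive_head _))).
have rbehead : recursive1 code_behead.
  exact: (recursive_app1 recursive1_usnd (recursive_pred (recursive_head _))).
apply: recursive_count; first exact: recursive_head.
apply: decidable_all; first by prove_recursive.
apply: decidable_has; first by prove_recursive.
apply: decidable_eq; last by prove_recursive.
by apply: (recursive_app1 rhead); apply: recursive_iter => //; prove_recursive.
Qed.

Lemma size_code_seq s : size s <= code_seq s.
Proof.
elim: s => //= o s IHs; rewrite ltnS; apply: leq_trans IHs _.
rewrite /npair; apply: leq_trans (leq_addr _ _).
exact: leq_trans (leq_addl _ _) (leq_tri_id _).
Qed.

Lemma code_memE x s : code_mem x (code_seq s) = (Some x \in s).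
Proof.
have iterE i : iter i code_behead (code_seq s) = code_seq (drop i s).
  elim: i => [|i IHi]; first by rewrite drop0.
  rewrite iterS IHi -[i.+1]add1n -drop_drop drop1.
  by case: (drop i s) => //= o s'; rewrite /code_behead /= usnd_npair.
have headE i : code_head (iter i code_behead (code_seq s))
    = code_option (nth None s i).
  rewrite iterE -[i in RHS]addn0 -nth_drop; case: (drop i s) => //= o s'.
  by rewrite /code_head ufst_npair.
apply/hasP/idP => [[i _]|xs].
  rewrite headE; have [si|si] := leqP (size s) i; first by rewrite nth_default.
  by case E: (nth None s i) => [y|] //= /eqP[<-]; rewrite -E mem_nth.
exists (index (Some x) s); last by rewrite headE nth_index.
by rewrite mem_iota /= (leq_trans _ (size_code_seq s)) // index_mem.
Qed.

(** The [x] for which all of 0, ..., [x] occur form an initial segment of length [k]. The bound on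
    [k] ensures that counting up to the code of [s] reaches the end of it. *)
Lemma mex_code_seq s k : k <= size s -> Some k \notin s ->
  (forall x, x < k -> Some x \in s) -> mex (code_seq s) = k.
Proof.
move=> ks kNs lt_k; apply: count_ltn_iota => [x|]; last first.
  exact: leq_trans ks (size_code_seq s).
apply/allP/idP => [all_s|xk y].
  rewrite ltnNge; apply: contra kNs => kx.
  by rewrite -code_memE all_s // mem_iota /= ltnS.
by rewrite mem_iota code_memE /= ltnS => yx; apply/lt_k/(leq_ltn_trans yx).
Qed.

(** * Prefixes of texts *)

Lemma mem_prefix_of T m n x :
  m <= n -> Some x \in prefix_of T m -> Some x \in prefix_of T n.
Proof.
move=> mn /mapP[i]; rewrite mem_iota /= => im ->; apply/mapP; exists i => //.
by rewrite mem_iota /= (leq_trans im).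
Qed.

Lemma prefix_of_text L T n x : text_for L T -> Some x \in prefix_of T n -> L x.
Proof. by move=> <- /mapP[i _ xi]; exists i. Qed.

Lemma text_exhausts L T k : text_for L T -> (forall x, x < k -> L x) ->
  exists n, forall x, x < k -> Some x \in prefix_of T n.
Proof.
move=> TL; elim: k => [|k IHk] kL; first by exists 0.
have [|n nP] := IHk; first by move=> x /ltnW; exact: kL.
have := kL _ (ltnSn k); rewrite -TL => -[i Ti].
exists (maxn n i.+1) => x; rewrite ltnS leq_eqVlt => /predU1P[->|xk].
  by apply/mapP; exists i; rewrite // mem_iota /= leq_maxr.
exact: mem_prefix_of (leq_maxl _ _) (nP _ xk).
Qed.

(** * The sets of the ascending family *)

Section Ascending.
Variables (eta : nat -> nat -> Prop) (heta : positive_equivalence eta).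

Local Notation a := (least_seq eta).
Local Notation A := (ascending eta).

Let eta_refl x : eta x x.
Proof. by case: heta. Qed.

Let eta_sym x y : eta x y -> eta y x.
Proof. by case: heta => _ h _ _ _; exact: h. Qed.

Let eta_trans x y z : eta x y -> eta y z -> eta x z.
Proof. by case: heta => _ _ h _ _; exact: h. Qed.

Lemma ltn_least_seq m n : m < n -> a m < a n.
Proof. by have [h _] := least_seqP heta; exact: h. Qed.

Lemma leq_least_seq : {mono a : m n / m <= n}.
Proof. by apply: leq_mono => m n; exact: ltn_least_seq. Qed.

Lemma leq_least_seq_id n : n <= a n.
Proof. by elim: n => // n /leq_ltn_trans; apply; apply: ltn_least_seq. Qed.

Lemma least_seq_least n y : eta y (a n) -> a n <= y.
Proof.
have [_ aP] := least_seqP heta.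
have : least_elements eta (a n) by rewrite -aP; exists n.
exact.
Qed.

Lemma least_seq_surj z : least_elements eta z -> exists n, a n = z.
Proof. by have [_ <-] := least_seqP heta; case=> n _ <-; exists n. Qed.

(** This trades least elements of classes for arbitrary members, which can be found by enumerating
    [eta]. From right to left, the least member of the class of [y] is some [a i <= y < a k], whence
    [i < k]. *)
Lemma ascendingE k x : A k x <-> exists2 y, eta y x & y < a k.
Proof.
split=> [[_ [i /= ik <-] xi]|[y yx yk]].
  by exists (a i); [exact: eta_sym | exact: ltn_least_seq].
have exz : exists z, `[< eta z y >] by exists y; apply/asboolP.
case: (ex_minnP exz) => z /asboolP zy zmin.
have [|i iz] := @least_seq_surj z.
  by move=> w wz; apply/zmin/asboolP; exact: eta_trans zy.
exists z; last by apply: eta_sym; exact: eta_trans yx.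
exists i => //=; rewrite -(leqW_mono leq_least_seq) iz.
by apply: leq_ltn_trans yk; apply/zmin/asboolP.
Qed.

Lemma ascending_lt k x : x < a k -> A k x.
Proof. by move=> xk; apply/ascendingE; exists x. Qed.

Lemma ascendingN k : ~ A k (a k).
Proof. by case/ascendingE => y /least_seq_least; rewrite leqNgt => /negP. Qed.

Lemma ascending_mono m n : m <= n -> A m `<=` A n.
Proof.
rewrite -leq_least_seq => mn x /ascendingE[y yx ym].
by apply/ascendingE; exists y => //; exact: leq_trans mn.
Qed.

Lemma ascending_inj : injective A.
Proof.
have lt_neq m n : m < n -> A m <> A n.
  move=> mn AA; apply: (@ascendingN m); rewrite AA.
  by apply: ascending_lt; exact: ltn_least_seq.
move=> m n AA; case: (ltngtP m n) => // [mn|nm].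
  by case: (lt_neq _ _ mn).
by case: (lt_neq _ _ nm).
Qed.

Lemma ascendingNT n : A n <> setT.
Proof. by move=> AT; apply: (@ascendingN n); rewrite AT. Qed.

Lemma eta_closure_ltn m : eta_closure eta [set x | x < a m] = A m.
Proof.
apply/seteqP; split=> [x [y /= ym xy]|x /ascendingE[y yx ym]].
  by apply/ascendingE; exists y => //; exact: eta_sym.
by exists y => //; exact: eta_sym.
Qed.

(** * Explanatory learning by the least unseen number *)

Lemma ascending_explanatorily_learnable W :
  acceptable_numbering W ->
  explanatorily_learnable W eta (ascending_family eta).
Proof.
case=> _ Wacc.
have [f rf fP] : exists2 f, recursive1 f & forall m, [set x | x < m] = W (f m).
  apply: (Wacc (fun m => [set x | x < m])).
  (* The dummy witness [w] brings the relation into the form that [re2_projection] expects. *)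
  have -> : (fun m => [set x | x < m]) = fun m x => exists w : nat, x < m.
    apply/funext => m; apply/funext => x; apply/propext.
    by split=> [xm|[]//]; exists 0.
  apply: (re2_projection (P := fun m x _ => x < m)).
  apply: decidable_leq; last exact: recursive1_ufst.
  exact/recursive_S/(recursive_app1 recursive1_ufst recursive1_usnd).
exists (fun s => Some (f (mex (code_seq s)))).
  exists (fun c => (f (mex c)).+1) => //.
  exact/recursive_S/(recursive_app1 rf recursive1_mex).
move=> _ T [n _ <-] TA; exists (f (a n)); split.
  by rewrite /hypothesis -fP eta_closure_ltn.
have [N NP] := text_exhausts TA (@ascending_lt n).
(* From [N] on, every number below [a n] has been seen. From [a n] on, the prefix is long enough for
   [mex_code_seq]. *)
exists (maxn N (a n)) => m; rewrite geq_max => /andP[Nm am].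
congr (Some (f _)); apply: mex_code_seq => [||x xa].
- by rewrite size_mkseq.
- by apply/negP => /(prefix_of_text TA)/ascendingN.
- exact/(mem_prefix_of Nm)/NP.
Qed.

(** * A uniformly r.e. numbering, with nat at index 0 and each [A k] at index [k.+1] *)

Lemma re2_ascending : re2 (fun k x => k = 0 \/ A k.-1 x).
Proof.
have [_ _ _ reta _] := heta.
have [|f rf fP] := re2_enumeration reta; first by exists 0, 0.
(* [unrefuted s z]: the first s pairs f enumerates do not show z non-least. *)
pose unrefuted s z :=
  all (fun t => ~~ has (fun w => f t == npair w z) (iota 0 z)) (iota 0 s).
(* The witness [c] codes a triple [y], [t], [s]: [f t] certifies [eta y x], and after [s] stages
   fewer than [k] numbers up to [y] still look least. Because of the index shift, this means at most
   [k.-1] of them, that is, [y < a k.-1]. *)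
pose P k x c := (k == 0) || (f (ufst (usnd c)) == npair (ufst c) x) &&
  (count (unrefuted (usnd (usnd c))) (iota 0 (ufst c).+1) < k).
suff -> : (fun k x => k = 0 \/ A k.-1 x) = fun k x => exists c, P k x c.
  have rf0 := recursive1_ufst; have rs0 := recursive1_usnd.
  apply: re2_projection; apply: decidable_or.
    by apply: decidable_eq; [exact: rf0|exact: recursive_cst].
  have rc := recursive_app1 rs0 rs0.
  apply: decidable_and.
    apply: decidable_eq.
      exact: (recursive_app1 rf (recursive_app1 rf0 (recursive_app1 rs0 rc))).
    apply: recursive_npair; first exact: (recursive_app1 rf0 rc).
    exact: (recursive_app1 rf0 rs0).
  apply: decidable_leq; last exact: rf0.
  apply/recursive_S/recursive_count.
    exact/recursive_S/(recursive_app1 rf0 rc).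
  apply: decidable_all.
    apply: (recursive_behead (f := fun t => usnd (usnd (usnd (usnd (thead t)))))).
    exact: (recursive_app1 rs0 (recursive_app1 rs0 rc)).
  apply: decidable_neg; apply: decidable_has; first by prove_recursive.
  apply: decidable_eq; first by apply: (recursive_app1 rf); prove_recursive.
  by apply: recursive_npair; prove_recursive.
(* True least elements are never refuted, so the count at any stage is at least the true one. *)
have least_unrefuted s z : least_elements eta z -> unrefuted s z.
  move=> lz; apply/allP => t _; apply/hasPn => w; rewrite mem_iota /= => wz.
  apply/negP => /eqP fwz; move: wz; rewrite ltnNge lz //; apply/fP.
  by exists t.
(* For suitable [s] the count is exact: each of the finitely many non-least [z <= y] is refuted at
   some stage, and refutations persist. *)
have refute y : exists s,
    forall z, z <= y -> unrefuted s z -> least_elements eta z.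
  have refute1 z : exists s, unrefuted s z -> least_elements eta z.
    have [lz|nlz] := pselect (least_elements eta z); first by exists 0.
    have [w [wz weta]] : exists w, w < z /\ eta w z.
      apply: contrapT => no; apply: nlz => w wz; rewrite leqNgt.
      by apply/negP => lt; apply: no; exists w.
    have [t ft] := (fP _ _).1 weta.
    exists t.+1 => /allP/(_ t); rewrite mem_iota /= leqnn => /(_ isT)/hasPn/(_ w).
    by rewrite mem_iota ft eqxx /= => /(_ wz).
  have unrefuted_le s s' z : s <= s' -> unrefuted s' z -> unrefuted s z.
    move=> ss' /allP us'; apply/allP => t; rewrite mem_iota => /= ts.
    by apply: us'; rewrite mem_iota /= (leq_trans ts).
  elim: y => [|y [s sP]].
    by have [s sP] := refute1 0; exists s => z; rewrite leqn0 => /eqP->.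
  have [s' s'P] := refute1 y.+1.
  exists (maxn s s') => z; rewrite leq_eqVlt => /predU1P[->|zy] uz.
    by apply/s'P/(unrefuted_le _ _ _ _ uz); exact: leq_maxr.
  by apply: sP => //; apply: (unrefuted_le _ _ _ _ uz); exact: leq_maxl.
apply/funext => -[|k]; apply/funext => x; apply/propext.
  by split=> _; [exists 0 | left].
split=> [[//|/ascendingE[y yx yk]]|[c /orP[//|/andP[/eqP fc cnt]]]].
  have [t ft] := (fP _ _).1 yx; have [s sP] := refute y.
  exists (npair y (npair t s)).
  rewrite /P !(ufst_npair, usnd_npair) ft eqxx ltnS; apply/orP; right.
  (* At stage [s] the surviving numbers up to [y] are all among [a 0], ..., [a k.-1], because
     [y < a k]. *)
  rewrite -size_filter -(size_iota 0 k) -(size_map a (iota 0 k)).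
  apply: uniq_leq_size => [|z]; first exact/filter_uniq/iota_uniq.
  rewrite mem_filter mem_iota /= ltnS => /andP[uz zy].
  have [i iz] := least_seq_surj (sP _ zy uz).
  apply/mapP; exists i => //; rewrite mem_iota /= -(leqW_mono leq_least_seq) iz.
  exact: leq_ltn_trans yk.
right; apply/ascendingE; exists (ufst c).
  by apply/fP; exists (ufst (usnd c)).
rewrite ltnNge; apply: contraL cnt => kc; rewrite ltnS -ltnNge.
(* If [a k] were at most [y], then [a 0], ..., [a k] would be [k.+1] distinct survivors, too many
   for [P]. *)
rewrite -size_filter -(size_iota 0 k.+1) -(size_map a (iota 0 k.+1)).
apply: uniq_leq_size => [|_ /mapP[i + ->]].
  by rewrite map_inj_uniq ?iota_uniq //; exact: incn_inj leq_least_seq.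
rewrite mem_iota mem_filter mem_iota /= !ltnS => ik.
rewrite (leq_trans _ kc) ?leq_least_seq // andbT; apply: least_unrefuted.
exact: least_seq_least.
Qed.

Lemma eta_family_ascending :
  eta_family eta (ascending_family eta `|` [set setT]).
Proof.
pose B k : set nat := fun x => k = 0 \/ A k.-1 x.
have B0 : B 0 = setT by apply/seteqP; split=> // x _; left.
have BS k : B k.+1 = A k.
  by apply/seteqP; split=> [x []//|x Ax]; right.
have Binj : injective B.
  move=> [|m] [|n]; rewrite ?B0 ?BS //.
  - by move/esym/ascendingNT.
  - by move/ascendingNT.
  - by move/ascending_inj ->.
have rB : range B = ascending_family eta `|` [set setT].
  apply/seteqP; split=> [_ [[|k] _ <-]|_ [[k _ <-]|->]].
  - by right; rewrite B0.
  - by left; exists k.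
  - by exists k.+1.
  - by exists 0.
split; last by exists B; split=> //; exact: re2_ascending.
  rewrite -rB (eq_finite_set (inj_card_eq (in2W Binj))).
  exact: infinite_nat.
move=> _ [[n _ <-]|->]; first by exists [set a i | i in [set i | i < n]].
by exists setT; apply/seteqP; split=> // x _; exists x.
Qed.

(** * A text for nat on which every [A n] is conjectured *)

Lemma diagonal_text W M : BC_learns W eta M (ascending_family eta) ->
  exists T, text_for setT T /\
    forall n, exists m, n <= m /\
      exists2 e, M (prefix_of T m) = Some e & hypothesis W eta e = A n.
Proof.
move=> learns.
pose within n (s : seq (option nat)) := forall x, Some x \in s -> A n x.
(* The content condition is a premise inside the existential, so that [choice] yields an extension
   function defined on all pairs. *)
have step (ns : nat * seq (option nat)) : exists s : seq (option nat),
    within ns.1 ns.2 ->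
    [/\ within ns.1 (ns.2 ++ s), ns.1 < size s,
      forall x, x < ns.1 -> Some x \in ns.2 ++ s
    & exists2 e, M (ns.2 ++ s) = Some e & hypothesis W eta e = A ns.1].
  case: ns => n s /=.
  have [sA|//] := pselect (within n s); last by exists [::].
  (* After [s], each [x] of [A n] is placed at position [size s + x], and the other positions are
     pauses. *)
  pose T i := if i < size s then nth None s i
    else if `[< A n (i - size s) >] then Some (i - size s) else None.
  have TA : text_for (A n) T.
    apply/seteqP; split=> [x [i]|x Ax].
      rewrite /T; case: ltnP => [lt_i sx|_].
        by apply: sA; rewrite -sx mem_nth.
      by case: asboolP => // Ai [<-].
    exists (size s + x); rewrite /T ltnNge leq_addr addKn /=.
    by case: asboolP.
  have [n0 n0P] := learns _ _ (ex_intro2 _ _ n I erefl) TA.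
  (* [n0] makes the conjecture correct; [n.+1] makes the extension long and lets every [x < n]
     appear in it. *)
  pose m := maxn n0 n.+1.
  have prefE : prefix_of T (size s + m) = s ++ mkseq (fun i => T (size s + i)) m.
    apply: (@eq_from_nth _ None) => [|i]; rewrite ?size_cat !size_mkseq //.
    move=> im; rewrite nth_mkseq // nth_cat /T; case: ltnP => // si.
    have im' : i - size s < m by rewrite -(ltn_add2l (size s)) subnKC.
    by rewrite nth_mkseq // subnKC // ltnNge si.
  exists (mkseq (fun i => T (size s + i)) m) => _; rewrite -prefE; split.
  - by move=> x; exact: prefix_of_text.
  - by rewrite size_mkseq leq_maxr.
  - move=> x xn; apply/mapP; exists (size s + x).
      by rewrite mem_iota /= ltn_add2l leq_max (leqW xn) orbT.
    rewrite /T ltnNge leq_addr addKn /=; case: asboolP => // -[].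
    by apply/ascending_lt/(leq_trans xn)/leq_least_seq_id.
  - by apply: n0P; rewrite (leq_trans (leq_maxl n0 n.+1)) // leq_addl.
have [ext extP] := choice step.
pose sigma := fix sigma n :=
  if n is k.+1 then sigma k ++ ext (k, sigma k) else [::].
(* [sigma n.+1] has its content already in [A n], and on it [M] conjectures [A n]; monotonicity then
   permits the move to [A n.+1]. *)
have sigmaA n : within n (sigma n).
  elim: n => // n IHn x xs; apply: (ascending_mono (leqnSn n)).
  by have [/(_ x xs)] := extP (n, sigma n) IHn.
have sigmaP n := extP (n, sigma n) (sigmaA n).
have lt_size n : n <= size (sigma n).
  elim: n => // n IHn; rewrite /= size_cat.
  by have [_ /= lt_n _ _] := sigmaP n; rewrite (leq_trans lt_n) ?leq_addl.
have sigma_nth m n i : m <= n -> i < size (sigma m) ->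
    nth None (sigma n) i = nth None (sigma m) i.
  move=> mn im; elim: n mn => [|n IHn]; first by rewrite leqn0 => /eqP ->.
  rewrite leq_eqVlt => /predU1P[<-//|]; rewrite ltnS => mn.
  rewrite /= nth_cat ifT ?IHn //; apply: (leq_trans im).
  elim: n mn {IHn} => [|n IHn]; first by rewrite leqn0 => /eqP ->.
  rewrite leq_eqVlt => /predU1P[<-//|]; rewrite ltnS => /IHn mn.
  by rewrite /= size_cat (leq_trans mn) ?leq_addr.
(* By [lt_size], position [i] lies inside [sigma i.+1], so the default is never reached; later
   extensions leave it unchanged. *)
pose T i := nth None (sigma i.+1) i.
have prefT n : prefix_of T (size (sigma n)) = sigma n.
  apply: (@eq_from_nth _ None); rewrite size_mkseq // => i i_n.
  rewrite nth_mkseq // /T; case: (leqP i.+1 n) => [lt_i|le_n].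
    by rewrite (sigma_nth _ _ _ lt_i).
  by rewrite (sigma_nth _ _ _ (ltnW le_n)).
exists T; split.
  apply/seteqP; split=> // x _.
  (* Stage [n] guarantees only the numbers strictly below [n], so [x] is sought at stage [x.+1]. *)
  have [_ _ /(_ x (leqnn _)) + _] := sigmaP x.+1.
  rewrite -[_ ++ _]/(sigma x.+2) -prefT => /mapP[i _ xi]; by exists i.
move=> n; exists (size (sigma n.+1)); split; first exact: ltnW.
by rewrite prefT; have [_ _ _] := sigmaP n.
Qed.

End Ascending.

Theorem theorem2 (W : nat -> set nat) (eta : nat -> nat -> Prop)
    (hW : acceptable_numbering W) (heta : positive_equivalence eta) :
  [/\ explanatorily_learnable W eta (ascending_family eta),
      ~ confidently_learnable W eta (ascending_family eta),
      eta_family eta (ascending_family eta `|` [set setT])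
    & ~ behaviourally_correctly_learnable W eta
          (ascending_family eta `|` [set setT])].
Proof.
split.
- exact: ascending_explanatorily_learnable.
- move=> [M [_ exM confM]].
  have bcM : BC_learns W eta M (ascending_family eta).
    move=> L T AL TL; have [e [eL [n0 n0P]]] := exM L T AL TL.
    by exists n0 => n /n0P ->; exists e.
  have [T [TT diagT]] := diagonal_text heta bcM.
  have [o [n0 n0P]] := confM _ _ TT.
  have conv n : n0 <= n ->
      exists2 e, o = Some e & hypothesis W eta e = ascending eta n.
    move=> n0n; have [m [nm [e Me eA]]] := diagT n.
    by exists e; rewrite // -Me n0P // (leq_trans n0n).
  (* The limit output [o] would have to denote both [A n0] and [A n0.+1]. *)
  have [e oe eA] := conv _ (leqnn n0).
  have [e' + eA'] := conv _ (leqnSn n0); rewrite oe => -[ee'].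
  have /(ascending_inj heta)/eqP : ascending eta n0 = ascending eta n0.+1.
    by rewrite -eA ee'.
  by rewrite ltn_eqF.
- exact: eta_family_ascending.
- move=> [M _ bcM].
  have [T [TT diagT]] :=
    diagonal_text heta (fun L T AL => bcM L T (or_introl AL)).
  (* As [T] is a text for nat, [M] must conjecture nat from [n0] on, but it conjectures [A n0] at
     some later prefix. *)
  have [n0 n0P] := bcM setT T (or_intror erefl) TT.
  have [m [n0m [e Me eA]]] := diagT n0.
  have [e' + eT] := n0P m n0m; rewrite Me => -[ee'].
  by apply: (@ascendingNT _ heta n0); rewrite -eA ee'.
Qed.
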